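(* Let $\mathcal{E}$ be a topos, $j$ and $k$ local operators on $\mathcal{E}$, and $k'$ a local operator on $\mathbf{sh}_j(\mathcal{E})$ which is the relativization of $k$ at $j$. Then (i) $\mathbf{sh}_{k'}(\mathbf{sh}_j(\mathcal{E}))=\mathbf{sh}_{k\vee j}(\mathcal{E})$, where $k\vee j$ is the join of $k$ and $j$ in the lattice of local operators on $\mathcal{E}$; (ii) for any subobject $m$ in $\mathbf{sh}_j(\mathcal{E})$, $c_{k'}(m)=c_k(m)$; (iii) if $k\geq j$ then for any subobject $m$ in $\mathcal{E}$, $c_{k'}(L_jm)=c_k(m)$.
   Context: For a local operator $j:\Omega\to\Omega$ on a topos $\mathcal{E}$ with subobject classifier $\Omega$: $\mathbf{sh}_j(\mathcal{E})$ is the topos of $j$-sheaves, $L_j$ is the associated cartesian reflector (sheafification) with unit $\eta$, and $c_j$ is the associated universal closure operation on subobjects, where, for $m:A'\rightarrowtail A$, $c_j(m)$ is the pullback of $L_jm$ along $\eta_A:A\to L_jA$. Similarly, $c_{k'}$ denotes the universal closure operation on $\mathbf{sh}_j(\mathcal{E})$ associated to a local operator $k'$ on $\mathbf{sh}_j(\mathcal{E})$. The arrow $e_j:\Omega_j\rightarrowtail\Omega$ is the equalizer of $1_\Omega,j:\Omega\to\Omega$; $\Omega_j$ is the subobject classifier of $\mathbf{sh}_j(\mathcal{E})$. Local operators on $\mathcal{E}$ are ordered by: $j\leq k$ iff $\mathbf{sh}_k(\mathcal{E})\subseteq\mathbf{sh}_j(\mathcal{E})$. A local operator $k':\Omega_j\to\Omega_j$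 on $\mathbf{sh}_j(\mathcal{E})$ is the relativization of $k$ at $j$ if $e_j\circ k'=k\circ e_j$ in $\mathcal{E}$. The topos $\mathbf{sh}_{k'}(\mathbf{sh}_j(\mathcal{E}))$ is regarded as a subtopos of $\mathcal{E}$ via the composite inclusion $\mathbf{sh}_{k'}(\mathbf{sh}_j(\mathcal{E}))\hookrightarrow\mathbf{sh}_j(\mathcal{E})\hookrightarrow\mathcal{E}$. *)

(* Defs.v *)
From Stdlib Require Import Setoid.
From Corelib Require Import ssreflect.

Set Implicit Arguments.
Unset Strict Implicit.
Unset Printing Implicit Defensive.

Record Category := {
  Ob :> Type;
  Hom : Ob -> Ob -> Type;
  idm : forall A, Hom A A;
  comp : forall A B C, Hom B C -> Hom A B -> Hom A C;
  comp_idl : forall A B (f : Hom A B), comp (idm B) f = f;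
  comp_idr : forall A B (f : Hom A B), comp f (idm A) = f;
  compA : forall A B C D (h : Hom C D) (g : Hom B C) (f : Hom A B),
    comp h (comp g f) = comp (comp h g) f
}.

Arguments Hom {c} A B.
Arguments idm {c} A.
Arguments comp {c A B C} g f.

Declare Scope topos_scope.
Open Scope topos_scope.
Notation "g ∘ f" := (comp g f) (at level 40, left associativity) : topos_scope.

Definition mono (C : Category) (A B : C) (m : Hom A B) : Prop :=
  forall (X : C) (f g : Hom X A), m ∘ f = m ∘ g -> f = g.

Definition is_terminal (C : Category) (T : C) : Prop :=
  forall X : C, exists ! h : Hom X T, True.

Definition is_pullback (C : Category) (P A B D : C)
    (p : Hom P A) (q : Hom P B) (f : Hom A D) (g : Hom B D) : Prop :=
  f ∘ p = g ∘ q /\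
  forall (X : C) (a : Hom X A) (b : Hom X B), f ∘ a = g ∘ b ->
    exists ! h : Hom X P, p ∘ h = a /\ q ∘ h = b.

(* An elementary topos; finite limits are given by a terminal object, binary
   products and equalizers, and [exp A B] is the exponential [B^A]. *)
Record Topos := {
  topos_cat :> Category;

  one : topos_cat;
  bang : forall A : topos_cat, Hom A one;
  bang_uniq : forall (A : topos_cat) (f : Hom A one), f = bang A;

  prod : topos_cat -> topos_cat -> topos_cat;
  fst : forall A B, Hom (prod A B) A;
  snd : forall A B, Hom (prod A B) B;
  pair : forall X A B, Hom X A -> Hom X B -> Hom X (prod A B);
  fst_pair : forall X A B (f : Hom X A) (g : Hom X B), fst A B ∘ pair f g = f;
  snd_pair : forall X A B (f : Hom X A) (g : Hom X B), snd A B ∘ pair f g = g;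
  pair_uniq : forall X A B (h k : Hom X (prod A B)),
    fst A B ∘ h = fst A B ∘ k -> snd A B ∘ h = snd A B ∘ k -> h = k;

  eqz : forall A B : topos_cat, Hom A B -> Hom A B -> topos_cat;
  eqz_arr : forall (A B : topos_cat) (f g : Hom A B), Hom (eqz f g) A;
  eqz_eq : forall (A B : topos_cat) (f g : Hom A B),
    f ∘ eqz_arr f g = g ∘ eqz_arr f g;
  eqz_lift : forall (A B : topos_cat) (f g : Hom A B) (X : topos_cat)
    (h : Hom X A), f ∘ h = g ∘ h -> Hom X (eqz f g);
  eqz_liftE : forall (A B : topos_cat) (f g : Hom A B) (X : topos_cat)
    (h : Hom X A) (e : f ∘ h = g ∘ h), eqz_arr f g ∘ eqz_lift e = h;
  eqz_mono : forall (A B : topos_cat) (f g : Hom A B), mono (eqz_arr f g);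

  exp : topos_cat -> topos_cat -> topos_cat;
  ev : forall A B, Hom (prod (exp A B) A) B;
  curry : forall X A B, Hom (prod X A) B -> Hom X (exp A B);
  curryE : forall X A B (f : Hom (prod X A) B),
    ev A B ∘ pair (curry f ∘ fst X A) (snd X A) = f;
  curry_uniq : forall X A B (h : Hom X (exp A B)),
    h = curry (ev A B ∘ pair (h ∘ fst X A) (snd X A));

  Omega : topos_cat;
  tr : Hom one Omega;
  chi : forall (U A : topos_cat) (m : Hom U A), mono m -> Hom A Omega;
  chi_pb : forall (U A : topos_cat) (m : Hom U A) (hm : mono m),
    is_pullback m (bang U) (chi hm) tr;
  chi_uniq : forall (U A : topos_cat) (m : Hom U A) (hm : mono m)
    (x : Hom A Omega), is_pullback m (bang U) x tr -> x = chi hm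
}.

Arguments one {t}.
Arguments bang {t} A.
Arguments prod {t} A B.
Arguments fst {t A B}.
Arguments snd {t A B}.
Arguments pair {t X A B} f g.
Arguments eqz {t A B} f g.
Arguments eqz_arr {t A B} f g.
Arguments eqz_lift {t A B f g X h} e.
Arguments exp {t} A B.
Arguments ev {t A B}.
Arguments curry {t X A B} f.
Arguments Omega t : clear implicits.
Arguments tr {t}.
Arguments chi {t U A m} hm.

Definition truth (E : Topos) (A : E) : Hom A (Omega E) := tr ∘ bang A.
Arguments truth {E} A.

Lemma mono_from_one (E : Topos) (A : E) (a : Hom one A) : mono a.
Proof. by move=> X f g _; rewrite (bang_uniq f) (bang_uniq g). Qed.
Arguments mono_from_one {E A} a.

Definition meet (E : Topos) : Hom (prod (Omega E) (Omega E)) (Omega E) :=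
  chi (mono_from_one (pair (@tr E) (@tr E))).
Arguments meet E : clear implicits.

Record local_operator (E : Topos) := {
  lop :> Hom (Omega E) (Omega E);
  lop_tr : lop ∘ tr = tr;
  lop_idem : lop ∘ lop = lop;
  lop_meet : lop ∘ meet E = meet E ∘ pair (lop ∘ fst) (lop ∘ snd)
}.

(* [lop j ∘ chi hm] classifies the [j]-closure of [m]; density says that this
   closure is the maximal subobject. *)
Definition dense (E : Topos) (j : local_operator E) (U A : E) (m : Hom U A)
    (hm : mono m) : Prop :=
  lop j ∘ chi hm = truth A.

Definition is_sheaf (E : Topos) (j : local_operator E) (X : E) : Prop :=
  forall (U A : E) (m : Hom U A) (hm : mono m), dense j hm ->
    forall f : Hom U X, exists ! g : Hom A X, g ∘ m = f.

Definition lop_le (E : Topos) (j k : local_operator E) : Prop :=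
  forall X : E, is_sheaf k X -> is_sheaf j X.

Definition is_join (E : Topos) (k j l : local_operator E) : Prop :=
  lop_le k l /\ lop_le j l /\
  forall n : local_operator E, lop_le k n -> lop_le j n -> lop_le l n.

Definition Omega_j (E : Topos) (j : local_operator E) : E :=
  eqz (idm (Omega E)) (lop j).

Definition e_j (E : Topos) (j : local_operator E) : Hom (Omega_j j) (Omega E) :=
  eqz_arr (idm (Omega E)) (lop j).

Section SheafTopos.
Context (E : Topos) (j : local_operator E).
Implicit Types A B X U : E.

Lemma pair_comp X Y A B (f : Hom X A) (g : Hom X B) (h : Hom Y X) :
  @pair E _ _ _ f g ∘ h = pair (f ∘ h) (g ∘ h).
Proof. by apply: pair_uniq; rewrite compA ?fst_pair ?snd_pair. Qed.

Lemma truth_comp A X (f : Hom X A) : truth A ∘ f = truth X.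
Proof. by rewrite /truth -compA (bang_uniq (bang A ∘ f)). Qed.

Lemma chiP U A (m : Hom U A) (hm : mono m) X (f : Hom X A) :
  (exists h, m ∘ h = f) <-> chi hm ∘ f = truth X.
Proof.
have [e u] := chi_pb hm; split.
  by case=> h <-; rewrite compA e -compA (bang_uniq (bang U ∘ h)).
by move=> /u [h [[hf _] _]]; exists h.
Qed.

Lemma eqz_truth_pb A (x : Hom A (Omega E)) :
  is_pullback (eqz_arr x (truth A)) (bang _) x tr.
Proof.
split; first by rewrite eqz_eq truth_comp.
move=> X a b e.
have e' : x ∘ a = truth A ∘ a by rewrite e truth_comp (bang_uniq b).
exists (eqz_lift e'); split.
  by rewrite eqz_liftE (bang_uniq (_ ∘ _)) (bang_uniq b).
by move=> h [ha _]; apply: (@eqz_mono E); rewrite eqz_liftE ha.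
Qed.

Lemma chi_eqz A (x : Hom A (Omega E)) :
  chi (@eqz_mono E _ _ x (truth A)) = x.
Proof. by symmetry; apply: chi_uniq; exact: eqz_truth_pb. Qed.

Lemma omega_ext A (x y : Hom A (Omega E)) :
  (forall X (f : Hom X A), x ∘ f = truth X <-> y ∘ f = truth X) -> x = y.
Proof.
move=> xy; rewrite -(chi_eqz x); symmetry; apply: chi_uniq; split.
  by apply/xy; rewrite eqz_eq truth_comp.
move=> X a b e; have [_ u] := eqz_truth_pb x; apply: u.
suff -> : tr ∘ b = truth X by apply/xy; rewrite e (bang_uniq b).
by rewrite (bang_uniq b).
Qed.

Lemma meetP A (x y : Hom A (Omega E)) X (f : Hom X A) :
  (meet E ∘ pair x y) ∘ f = truth X <-> x ∘ f = truth X /\ y ∘ f = truth X.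
Proof.
rewrite -compA pair_comp; split.
  move=> /chiP [h e]; rewrite (bang_uniq h) in e.
  split.
    by move: (f_equal (comp fst) e); rewrite !compA !fst_pair => <-.
  by move: (f_equal (comp snd) e); rewrite !compA !snd_pair => <-.
by case=> -> ->; apply/chiP; exists (bang X); rewrite pair_comp.
Qed.

Lemma lop_truth A : lop j ∘ truth A = truth A.
Proof. by rewrite /truth compA lop_tr. Qed.

Lemma lop_infl A (x : Hom A (Omega E)) X (f : Hom X A) :
  x ∘ f = truth X -> (lop j ∘ x) ∘ f = truth X.
Proof. by move=> e; rewrite -compA e lop_truth. Qed.

Lemma lop_meetE A (x y : Hom A (Omega E)) :
  lop j ∘ (meet E ∘ pair x y) = meet E ∘ pair (lop j ∘ x) (lop j ∘ y).
Proof.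
by rewrite compA lop_meet -compA pair_comp -!compA fst_pair snd_pair.
Qed.

Lemma sheaf_sep X U A (m : Hom U A) (hm : mono m) (f g : Hom A X) :
  is_sheaf j X -> dense j hm -> f ∘ m = g ∘ m -> f = g.
Proof. by move=> sX dm e; have [h [_ u]] := sX _ _ _ _ dm (g ∘ m); rewrite -(u f) // -(u g). Qed.

Lemma sheaf_one : is_sheaf j one.
Proof.
move=> U A m hm _ f; exists (bang A); split.
  by rewrite (bang_uniq f) (bang_uniq (_ ∘ _)).
by move=> g _; rewrite (bang_uniq g).
Qed.

Lemma sheaf_prod A B : is_sheaf j A -> is_sheaf j B -> is_sheaf j (prod A B).
Proof.
move=> sA sB U Y m hm dm f.
have [a [ea _]] := sA _ _ _ _ dm (fst ∘ f).
have [b [eb _]] := sB _ _ _ _ dm (snd ∘ f).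
exists (pair a b); split.
  by apply: pair_uniq; rewrite compA ?fst_pair ?snd_pair.
move=> g eg; apply: pair_uniq; rewrite ?fst_pair ?snd_pair.
  by apply: (sheaf_sep sA dm); rewrite ea -eg compA.
by apply: (sheaf_sep sB dm); rewrite eb -eg compA.
Qed.

Lemma sheaf_eqz A B (f g : Hom A B) :
  is_sheaf j A -> is_sheaf j B -> is_sheaf j (eqz f g).
Proof.
move=> sA sB U Y m hm dm x.
have [a [ea _]] := sA _ _ _ _ dm (eqz_arr f g ∘ x).
have e : f ∘ a = g ∘ a.
  by apply: (sheaf_sep sB dm); rewrite -!compA ea !compA eqz_eq.
exists (eqz_lift e); split.
  by apply: (@eqz_mono E); rewrite compA eqz_liftE.
move=> y ey; apply: (@eqz_mono E); rewrite eqz_liftE.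
by apply: (sheaf_sep sA dm); rewrite ea -ey compA.
Qed.

Lemma mono_times U A (m : Hom U A) B :
  mono m -> mono (@pair E _ _ B (m ∘ fst) snd).
Proof.
move=> hm X f g; rewrite !pair_comp => e; apply: pair_uniq.
  apply: hm.
  by move: (f_equal (comp fst) e); rewrite !fst_pair -!compA.
by move: (f_equal (comp snd) e); rewrite !snd_pair.
Qed.

Lemma dense_times U A (m : Hom U A) (hm : mono m) B :
  dense j hm -> dense j (@mono_times _ _ m B hm).
Proof.
rewrite /dense => dm.
suff -> : chi (@mono_times _ _ m B hm) = chi hm ∘ fst.
  by rewrite compA dm truth_comp.
apply: omega_ext => X f; rewrite -compA -!chiP; split.
  by case=> h <-; exists (fst ∘ h); rewrite !compA fst_pair.
case=> h e; exists (pair h (snd ∘ f)).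
by rewrite pair_comp -compA fst_pair snd_pair e; apply: pair_uniq;
   rewrite ?fst_pair ?snd_pair.
Qed.

Lemma curry_inj X A B (f g : Hom X (@exp E A B)) :
  ev ∘ pair (f ∘ fst) snd = ev ∘ pair (g ∘ fst) snd -> f = g.
Proof. by move=> e; rewrite (curry_uniq f) e -curry_uniq. Qed.

Lemma pair_times X Y Z B (f : Hom Y Z) (g : Hom X Y) :
  @pair E _ _ B (f ∘ fst) snd ∘ pair (g ∘ fst) snd = pair ((f ∘ g) ∘ fst) snd.
Proof. by rewrite pair_comp -!compA fst_pair snd_pair. Qed.

Lemma sheaf_exp A B : is_sheaf j B -> is_sheaf j (exp A B).
Proof.
move=> sB U Y m hm dm f.
have dmA := dense_times A dm.
have [a [ea ua]] := sB _ _ _ _ dmA (ev ∘ pair (f ∘ fst) snd).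
exists (curry a); split.
  by apply: curry_inj; rewrite -pair_times compA curryE.
move=> g eg; apply: curry_inj; rewrite curryE; apply: ua.
by rewrite -compA pair_times eg.
Qed.

Lemma closed_Omega_j A (x : Hom A (Omega_j j)) :
  lop j ∘ (e_j j ∘ x) = e_j j ∘ x.
Proof. by rewrite compA -eqz_eq comp_idl. Qed.

Lemma sheaf_Omega_j : is_sheaf j (Omega_j j).
Proof.
move=> U A m hm dm u.
pose s := eqz_arr (e_j j ∘ u) (truth U).
have hms : mono (m ∘ s).
  by move=> X f g; rewrite -!compA => e; apply: (@eqz_mono E); exact: hm e.
pose v0 := chi hms.
have v0m : v0 ∘ m = e_j j ∘ u.
  apply: omega_ext => X f; rewrite -compA -chiP.
  have <- : chi (@eqz_mono E _ _ (e_j j ∘ u) (truth U)) ∘ f =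
            (e_j j ∘ u) ∘ f by rewrite chi_eqz.
  rewrite -chiP; split=> -[h e]; exists h.
    by apply: (hm); rewrite compA.
  by rewrite -e compA.
have ve : idm _ ∘ (lop j ∘ v0) = lop j ∘ (lop j ∘ v0).
  by rewrite comp_idl compA lop_idem.
exists (eqz_lift ve); split.
  apply: (@eqz_mono E); rewrite compA eqz_liftE -compA v0m.
  exact: closed_Omega_j.
move=> g eg; apply: (@eqz_mono E); rewrite eqz_liftE -/(e_j j).
have key : forall w, lop j ∘ w = lop j ∘ (meet E ∘ pair w (chi hm)).
  move=> w; rewrite lop_meetE dm; apply: omega_ext => X f; rewrite meetP.
  by rewrite truth_comp; split=> [-> | []].
rewrite -(closed_Omega_j g) [LHS]key [RHS]key; congr (_ ∘ _).
apply: omega_ext => X f; rewrite !meetP.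
split=> -[h1 /[dup] h2 /chiP [h e]]; split=> //.
  by rewrite -h1 -e 2!compA v0m -eg !compA.
by rewrite -h1 -e 2!compA v0m -eg !compA.
Qed.

Record sheaf := Sheaf { sh_val : E; sh_prf : is_sheaf j sh_val }.
Arguments sh_prf s : clear implicits.

Definition sh_cat : Category := {|
  Ob := sheaf;
  Hom := fun A B : sheaf => Hom (sh_val A) (sh_val B);
  idm := fun A : sheaf => idm (sh_val A);
  comp := fun (A B C : sheaf) g f => g ∘ f;
  comp_idl := fun (A B : sheaf) f => comp_idl f;
  comp_idr := fun (A B : sheaf) f => comp_idr f;
  compA := fun (A B C D : sheaf) h g f => compA h g f
|}.

Lemma sh_mono (U A : sh_cat) (m : Hom U A) :
  mono m -> @mono E (sh_val U) (sh_val A) m.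
Proof.
move=> hm X f g e.
pose K := eqz (@comp E _ _ _ m fst) (@comp E _ _ _ m snd).
have sK : is_sheaf j K.
  by apply: sheaf_eqz; [apply: sheaf_prod|]; apply: sh_prf.
pose k := eqz_arr (@comp E _ _ _ m fst) (@comp E _ _ _ m snd).
have k12 : fst ∘ k = snd ∘ k.
  by apply: (hm (Sheaf sK)); rewrite /= !compA eqz_eq.
have efg : (@comp E _ _ _ m fst) ∘ pair f g = (@comp E _ _ _ m snd) ∘ pair f g.
  by rewrite -!compA fst_pair snd_pair.
have := eqz_liftE efg; rewrite -/k => ek.
by rewrite -(fst_pair f g) -ek compA k12 -compA ek snd_pair.
Qed.

Lemma sheaf_mono_closed (U A : E) (m : Hom U A) (hm : mono m) :
  is_sheaf j U -> is_sheaf j A -> lop j ∘ chi hm = chi hm.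
Proof.
move=> sU sA.
pose c := eqz_arr (lop j ∘ chi hm) (truth A).
have em : (lop j ∘ chi hm) ∘ m = truth A ∘ m.
  rewrite truth_comp; apply: lop_infl; apply/chiP.
  by exists (idm U); rewrite comp_idr.
pose d := eqz_lift em; have ed : c ∘ d = m := eqz_liftE em.
have hd : mono d by move=> X f g e; apply: (hm); rewrite -ed -!compA e.
have dd : dense j hd.
  rewrite /dense; suff -> : chi hd = chi hm ∘ c.
    by rewrite compA eqz_eq truth_comp.
  apply: omega_ext => X f; rewrite -compA -!chiP; split=> -[h e]; exists h.
    by rewrite -e compA ed.
  by apply: (@eqz_mono E); rewrite -/c compA ed.
have [r [er _]] := sU _ _ _ _ dd (idm U).
have mr : m ∘ r = c.
  by apply: (sheaf_sep sA dd); rewrite -compA er comp_idr ed.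
apply: omega_ext => X f; split; last exact: lop_infl.
move=> e0; have e : (lop j ∘ chi hm) ∘ f = truth A ∘ f by rewrite truth_comp.
apply/chiP.
by exists (r ∘ eqz_lift e); rewrite compA mr eqz_liftE.
Qed.

Definition sh_tr : Hom one (Omega_j j) :=
  @eqz_lift E _ _ (idm (Omega E)) (lop j) one tr
    (eq_trans (comp_idl tr) (eq_sym (lop_tr j))).

Lemma sh_trE : e_j j ∘ sh_tr = tr.
Proof. exact: eqz_liftE. Qed.

Lemma sh_chi_closed (U A : sh_cat) (m : Hom U A) (hm : mono m) :
  idm (Omega E) ∘ chi (sh_mono hm) = lop j ∘ chi (sh_mono hm).
Proof. by rewrite comp_idl sheaf_mono_closed //; apply: sh_prf. Qed.

Definition sh_chi (U A : sh_cat) (m : Hom U A) (hm : mono m) :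
    Hom (sh_val A) (Omega_j j) :=
  eqz_lift (sh_chi_closed hm).

Lemma sh_chiE (U A : sh_cat) (m : Hom U A) (hm : mono m) :
  e_j j ∘ sh_chi hm = chi (sh_mono hm).
Proof. exact: eqz_liftE. Qed.

Definition sh_one : sh_cat := Sheaf sheaf_one.
Definition sh_Omega : sh_cat := Sheaf sheaf_Omega_j.

Lemma sh_chi_pb (U A : sh_cat) (m : Hom U A) (hm : mono m) :
  @is_pullback sh_cat U A sh_one sh_Omega m (bang (sh_val U)) (sh_chi hm) sh_tr.
Proof.
have [e u] := chi_pb (sh_mono hm); split=> /=.
  by apply: (@eqz_mono E); rewrite !compA -/(e_j j) sh_chiE sh_trE.
move=> X a b eab; apply: u.
by rewrite -sh_chiE -sh_trE -!compA eab.
Qed.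

Lemma sh_chi_uniq (U A : sh_cat) (m : Hom U A) (hm : mono m)
    (x : @Hom sh_cat A sh_Omega) :
  @is_pullback sh_cat U A sh_one sh_Omega m (bang (sh_val U)) x sh_tr ->
  x = sh_chi hm.
Proof.
move=> [/= e u]; apply: (@eqz_mono E); rewrite -/(e_j j) sh_chiE.
apply: omega_ext => X f; rewrite -chiP; split; last first.
  have exm : (e_j j ∘ x) ∘ m = truth (sh_val U).
    by rewrite -compA e compA sh_trE.
  by case=> h <-; rewrite compA exm truth_comp.
move=> ef; pose y : @Hom E (sh_val A) (Omega_j j) := x.
pose t := sh_tr ∘ bang (sh_val A).
have sS : is_sheaf j (eqz y t).
  by apply: sheaf_eqz; [apply: sh_prf | apply: sheaf_Omega_j].
have [|h [[eh _] _]] := u (Sheaf sS) (eqz_arr y t) (bang _).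
  by rewrite [LHS](eqz_eq y t) -compA (bang_uniq (_ ∘ _)).
have ef' : y ∘ f = t ∘ f.
  apply: (@eqz_mono E); rewrite !compA -/(e_j j) sh_trE ef -/(truth _).
  by rewrite truth_comp.
by exists (h ∘ eqz_lift ef'); rewrite compA eh [LHS]eqz_liftE.
Qed.

Definition sh : Topos := {|
  topos_cat := sh_cat;
  one := sh_one;
  bang := fun A : sh_cat => bang (sh_val A);
  bang_uniq := fun (A : sh_cat) f => bang_uniq f;
  prod := fun A B : sh_cat => Sheaf (@sheaf_prod _ _ (sh_prf A) (sh_prf B));
  fst := fun (A B : sh_cat) => fst;
  snd := fun (A B : sh_cat) => snd;
  pair := fun (X A B : sh_cat) f g => pair f g;
  fst_pair := fun (X A B : sh_cat) f g => fst_pair f g;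
  snd_pair := fun (X A B : sh_cat) f g => snd_pair f g;
  pair_uniq := fun (X A B : sh_cat) h k => @pair_uniq E _ _ _ h k;
  eqz := fun (A B : sh_cat) f g =>
    Sheaf (@sheaf_eqz _ _ f g (sh_prf A) (sh_prf B));
  eqz_arr := fun (A B : sh_cat) f g => eqz_arr f g;
  eqz_eq := fun (A B : sh_cat) f g => eqz_eq f g;
  eqz_lift := fun (A B : sh_cat) f g (X : sh_cat) h e => eqz_lift e;
  eqz_liftE := fun (A B : sh_cat) f g (X : sh_cat) h e => eqz_liftE e;
  eqz_mono := fun (A B : sh_cat) f g (X : sh_cat) => @eqz_mono E _ _ f g (sh_val X);
  exp := fun A B : sh_cat => Sheaf (@sheaf_exp (sh_val A) _ (sh_prf B));
  ev := fun (A B : sh_cat) => ev;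
  curry := fun (X A B : sh_cat) f => curry f;
  curryE := fun (X A B : sh_cat) f => curryE f;
  curry_uniq := fun (X A B : sh_cat) h => curry_uniq h;
  Omega := sh_Omega;
  tr := sh_tr;
  chi := sh_chi;
  chi_pb := sh_chi_pb;
  chi_uniq := sh_chi_uniq
|}.

End SheafTopos.

Arguments sh {E} j.
Arguments Sheaf {E j} sh_val sh_prf.

(* The inclusion functor [sh j -> E] on arrows; it is the identity because
   [sh j] is a full subcategory. *)
Definition sh_arr (E : Topos) (j : local_operator E) (A B : sh j)
  (f : Hom A B) : Hom (sh_val A) (sh_val B) := f.

Definition is_relativization (E : Topos) (j k : local_operator E)
    (k' : local_operator (sh j)) : Prop :=
  e_j j ∘ sh_arr (lop k') = lop k ∘ e_j j.

Record Sub (E : Topos) (A : E) := {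
  sub_dom : E;
  sub_map : Hom sub_dom A;
  sub_mono : mono sub_map
}.

Definition sub_le (E : Topos) (A : E) (s t : Sub A) : Prop :=
  exists h : Hom (sub_dom s) (sub_dom t), sub_map t ∘ h = sub_map s.

(* Equality of subobjects, i.e. isomorphism of the representing monos over the
   common codomain. *)
Definition sub_eq (E : Topos) (A : E) (s t : Sub A) : Prop :=
  sub_le s t /\ sub_le t s.

Lemma mono_pull (E : Topos) (A B : E) (f : Hom A B) (t : Sub B) :
  mono (fst ∘ eqz_arr (f ∘ fst) (sub_map t ∘ snd)).
Proof.
move=> X a b; rewrite -!compA => e; apply: (@eqz_mono E); apply: pair_uniq => //.
apply: (sub_mono (s := t)).
by rewrite !compA -eqz_eq -!compA e.
Qed.

(* The pullback [f^* t], computed as an equalizer on the product. *)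
Definition sub_pull (E : Topos) (A B : E) (f : Hom A B) (t : Sub B) : Sub A :=
  {| sub_map := fst ∘ eqz_arr (f ∘ fst) (sub_map t ∘ snd);
     sub_mono := @mono_pull E A B f t |}.

Definition sub_incl (E : Topos) (j : local_operator E) (A : sh j) (s : Sub A) :
    Sub (sh_val A) :=
  {| sub_map := sh_arr (sub_map s);
     sub_mono := sh_mono (sub_mono (s := s)) |}.

(* A functor [E -> sh j] left adjoint to the inclusion, with unit [eta], and
   preserving finite limits. *)
Record sheafification (E : Topos) (j : local_operator E) := {
  L_ob : E -> sh j;
  L_map : forall A B : E, Hom A B -> Hom (L_ob A) (L_ob B);
  L_id : forall A : E, L_map (idm A) = idm (L_ob A);
  L_comp : forall (A B C : E) (g : Hom B C) (f : Hom A B),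
    L_map (g ∘ f) = L_map g ∘ L_map f;
  eta : forall A : E, Hom A (sh_val (L_ob A));
  eta_nat : forall (A B : E) (f : Hom A B),
    sh_arr (L_map f) ∘ eta A = eta B ∘ f;
  eta_univ : forall (A : E) (X : sh j) (f : Hom A (sh_val X)),
    exists ! g : Hom (L_ob A) X, sh_arr g ∘ eta A = f;
  L_one : is_terminal (L_ob one);
  L_pb : forall (P A B D : E) (p : Hom P A) (q : Hom P B)
      (f : Hom A D) (g : Hom B D),
    is_pullback p q f g ->
    is_pullback (L_map p) (L_map q) (L_map f) (L_map g)
}.

Lemma L_mono (E : Topos) (j : local_operator E) (L : sheafification j)
    (A B : E) (m : Hom A B) : mono m -> mono (L_map L m).
Proof.
move=> hm.
have /(L_pb L) [_ u] : is_pullback (idm A) (idm A) m m.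
  split=> // X a b /hm <-; exists a; split; first by rewrite comp_idl.
  by move=> h [<- _]; rewrite comp_idl.
move=> X f g /u [h [[<- <-] _]]; by rewrite L_id.
Qed.

Definition L_sub (E : Topos) (j : local_operator E) (L : sheafification j)
    (A : E) (m : Sub A) : Sub (L_ob L A) :=
  {| sub_map := L_map L (sub_map m);
     sub_mono := L_mono (L := L) (sub_mono (s := m)) |}.

(* The universal closure operation [c_j]: the pullback of [L_j m] along the
   unit. *)
Definition closure (E : Topos) (j : local_operator E) (L : sheafification j)
    (A : E) (m : Sub A) : Sub A :=
  sub_pull (eta L A) (sub_incl (L_sub L m)).

(* Main.v *)
From Corelib Require Import ssreflect.
Require Import Defs.

(** Relativization says that [k] preserves [j]-closed truth values, so [k ∘ j]
    is again a local operator. A mono is [k ∘ j]-dense iff its [j]-closure is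
    [k]-dense, hence the [k ∘ j]-sheaves are the common sheaves of [j] and [k]
    and [k ∘ j] is the join. If [X] is a [j]-sheaf and a [k']-sheaf, the
    singleton map embeds it as a [k ∘ j]-closed subobject of a power of
    [Omega_j (k ∘ j)], so it is a [k ∘ j]-sheaf; no sheafification is needed.

    For the closure operations, [closure L m] is classified by [lop j ∘ chi m],
    and everything is compared on classifying maps: (ii) is the relativization
    equation, and (iii) follows from [k ∘ j = k = j ∘ k] for [j] below [k]. *)

Set Implicit Arguments.
Unset Strict Implicit.
Unset Printing Implicit Defensive.

(** * Closed subobjects, and a mono into a power object *)

Section LocalOperator.
Context (E : Topos) (j : local_operator E).
Implicit Types A B U X : E.

(** The order is tested on generalized elements: [x] below [y] means that [x] is the meet of [x] and
    [y], and [j] preserves meets. *)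
Lemma lop_monotone A (x y : Hom A (Omega E)) :
  (forall X (f : Hom X A), x ∘ f = truth X -> y ∘ f = truth X) ->
  forall X (f : Hom X A), (lop j ∘ x) ∘ f = truth X ->
    (lop j ∘ y) ∘ f = truth X.
Proof.
move=> xy X f.
have -> : x = meet E ∘ pair x y.
  by apply: omega_ext => Y g; rewrite meetP; split=> [h|[]//]; split; auto.
by rewrite lop_meetE meetP => -[].
Qed.

Lemma closed_eq_truth U A (m : Hom U A) (hm : mono m) (x : Hom A (Omega E)) :
  dense j hm -> lop j ∘ x = x -> x ∘ m = truth U -> x = truth A.
Proof.
move=> dm cx xm; rewrite -cx -(comp_idr (lop j ∘ x)).
apply: (@lop_monotone _ (chi hm)); last by rewrite comp_idr.
by move=> X f /chiP [h <-]; rewrite compA xm truth_comp.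
Qed.

(** An extension into [A] satisfies [chi hm] on a dense subobject, hence everywhere because [chi hm]
    is closed, so it factors through [m]. *)
Lemma sheaf_closed_sub U A (m : Hom U A) (hm : mono m) :
  is_sheaf j A -> lop j ∘ chi hm = chi hm -> is_sheaf j U.
Proof.
move=> sA cm V B d hd dd f.
have [g [gd _]] := sA _ _ _ _ dd (m ∘ f).
have : chi hm ∘ g = truth B.
  apply: (closed_eq_truth dd); first by rewrite compA cm.
  by rewrite -compA gd; apply/chiP; exists f.
move=> /chiP [h mh]; exists h; split.
  by apply: (hm); rewrite compA mh.
move=> h' e; apply: (hm); rewrite mh.
by apply: (sheaf_sep sA dd); rewrite gd -e compA.
Qed.

Definition Omega_lift A (x : Hom A (Omega E)) (cx : lop j ∘ x = x) :
    Hom A (Omega_j j) :=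
  eqz_lift (eq_trans (comp_idl x) (eq_sym cx)).

Lemma Omega_liftE A (x : Hom A (Omega E)) (cx : lop j ∘ x = x) :
  e_j j ∘ Omega_lift cx = x.
Proof. exact: eqz_liftE. Qed.

Lemma lop_closed A (x : Hom A (Omega E)) : lop j ∘ (lop j ∘ x) = lop j ∘ x.
Proof. by rewrite compA lop_idem. Qed.

(** This is the singleton map, with truth values in a general [B] so that [B] can be an object of
    closed truth values. If the singletons of [f] and [g] agree, evaluating both at [f] puts the
    pair of [g] and [f] on the diagonal. *)
Lemma mono_curry_diag A B (x : Hom B (Omega E)) (b : Hom (prod A A) B)
    (hd : mono (@pair E _ _ _ (idm A) (idm A))) :
  x ∘ b = chi hd -> mono (curry b).
Proof.
move=> xb X f g e.
have ebx Y (h : Hom Y X) (a : Hom Y A) : b ∘ pair (f ∘ h) a = b ∘ pair (g ∘ h) a.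
  have ec (u : Hom X A) : b ∘ pair (u ∘ fst) snd =
      ev ∘ pair ((curry b ∘ u) ∘ fst) snd.
    by rewrite -pair_times compA curryE.
  have := f_equal (fun w => w ∘ pair h a) (ec f).
  rewrite e -ec -!compA !pair_comp -!compA fst_pair snd_pair; exact.
have : chi hd ∘ pair f f = truth X.
  by apply/chiP; exists f; rewrite pair_comp comp_idl.
have := ebx _ (idm X) f; rewrite !comp_idr => {}ebx.
rewrite -xb -compA ebx compA xb => /chiP [h]; rewrite pair_comp comp_idl => eh.
have := f_equal (comp fst) eh; have := f_equal (comp snd) eh.
by rewrite !fst_pair !snd_pair => <- <-.
Qed.

End LocalOperator.

(** * Subobjects compared through classifying maps *)

Section SubobjectClassifier.
Context (E : Topos).

Lemma sub_leP (A : E) (s t : Sub A) :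
  sub_le s t <->
  forall X (f : Hom X A), chi (sub_mono (s := s)) ∘ f = truth X ->
    chi (sub_mono (s := t)) ∘ f = truth X.
Proof.
split=> [[h e] X f /chiP [g <-]|le].
  by apply/chiP; exists (h ∘ g); rewrite compA e.
by apply/(chiP (sub_mono (s := t))); apply: le; apply/chiP; exists (idm _);
  rewrite comp_idr.
Qed.

Lemma sub_eqP (A : E) (s t : Sub A) :
  sub_eq s t <-> chi (sub_mono (s := s)) = chi (sub_mono (s := t)).
Proof.
rewrite /sub_eq !sub_leP; split=> [[st ts]|->]; last by split.
by apply: omega_ext => X f; split; auto.
Qed.

Lemma chi_pull (A B : E) (f : Hom A B) (t : Sub B) :
  chi (sub_mono (s := sub_pull f t)) = chi (sub_mono (s := t)) ∘ f.
Proof.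
apply: omega_ext => X a; rewrite -compA -!chiP /=; split=> -[h e].
  by exists (snd ∘ (eqz_arr _ _ ∘ h)); rewrite -e !compA eqz_eq.
have e' : (f ∘ fst) ∘ pair a h = (sub_map t ∘ snd) ∘ pair a h.
  by rewrite -!compA fst_pair snd_pair.
by exists (eqz_lift e'); rewrite -compA eqz_liftE fst_pair.
Qed.

End SubobjectClassifier.

(** One inequality extends the closed map [lop j ∘ chi hm] along the unit and finds the extension
    true on [L m]; the other uses naturality of the unit and closedness of [L m]. *)
Lemma chi_closure (E : Topos) (j : local_operator E) (L : sheafification j)
    (A : E) (m : Sub A) :
  chi (sub_mono (s := closure L m)) = lop j ∘ chi (sub_mono (s := m)).
Proof.
rewrite chi_pull.
set hm := sub_mono (s := m); set hL := sub_mono (s := sub_incl (L_sub L m)).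
have hmm : chi hm ∘ sub_map m = truth _ by apply/chiP; exists (idm _); rewrite comp_idr.
have cL : lop j ∘ chi hL = chi hL by apply: sheaf_mono_closed; apply: sh_prf.
apply: omega_ext => X f; split.
  pose w := Omega_lift (lop_closed j (chi hm)).
  have [v [ev _]] := @eta_univ _ _ L A (sh_Omega j) w.
  (* Both sides, as maps into [Omega_j j], extend [w ∘ sub_map m] along the unit. *)
  have vm : e_j j ∘ (v ∘ L_map L (sub_map m)) = truth (sh_val (L_ob L (sub_dom m))).
    have [y [_ uy]] := @eta_univ _ _ L (sub_dom m) (sh_Omega j) (w ∘ sub_map m).
    have t : lop j ∘ truth (sh_val (L_ob L (sub_dom m))) = truth _ by apply: lop_truth.
    rewrite -(Omega_liftE t); congr (_ ∘ _); transitivity y.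
      symmetry; apply: uy; rewrite /sh_arr /= -compA.
      by rewrite (eta_nat L (sub_map m)) compA -ev.
    apply: uy; apply: (@eqz_mono E); rewrite /sh_arr !compA -!/(e_j j).
    by rewrite !Omega_liftE truth_comp -compA hmm lop_truth.
  rewrite -compA => /chiP [h e].
  rewrite -(Omega_liftE (lop_closed j (chi hm))) -/w -ev -!compA -e /=.
  by move: vm; rewrite /sh_arr /= !compA => ->; rewrite truth_comp.
rewrite -cL -[(lop j ∘ _) ∘ eta L A]compA; apply: lop_monotone => Y g /chiP [h <-].
rewrite -compA; apply/chiP; exists (eta L _ ∘ h).
by rewrite /= compA eta_nat compA.
Qed.

(** * The order of local operators on truth values *)

Section Order.
Context (E : Topos).
Implicit Types j k l : local_operator E.

(** The subobject classified by [x ∘ f] is [j]-dense. On it [lop k ∘ (x ∘ f)] agrees with truth, and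
    both are maps into [Omega_j k], which is a [j]-sheaf. *)
Lemma lop_le_truth j k : lop_le j k ->
  forall (A : E) (x : Hom A (Omega E)) (X : E) (f : Hom X A),
    (lop j ∘ x) ∘ f = truth X -> (lop k ∘ x) ∘ f = truth X.
Proof.
move=> le_jk A x X f jx.
pose y := x ∘ f; pose hm := @eqz_mono E _ _ y (truth X).
have dm : dense j hm by rewrite /dense chi_eqz compA.
pose t := Omega_lift (lop_truth k X); pose u := Omega_lift (lop_closed k y).
rewrite -compA -[LHS](Omega_liftE (lop_closed k y)) -/u.
rewrite -[RHS](Omega_liftE (lop_truth k X)) -/t; congr (_ ∘ _).
apply: (sheaf_sep (le_jk _ (@sheaf_Omega_j E k)) dm).
apply: (@eqz_mono E); rewrite !compA -!/(e_j k) !Omega_liftE.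
by rewrite -compA eqz_eq truth_comp lop_truth.
Qed.

Lemma lop_le_compr j k : lop_le j k -> lop k ∘ lop j = lop k.
Proof.
move=> le_jk; apply: omega_ext => X f; split.
  rewrite -{2}(lop_idem k); apply: lop_monotone => Y g.
  by rewrite -[lop j]comp_idr -[lop k]comp_idr; apply: lop_le_truth.
rewrite -{1}(comp_idr (lop k)); apply: lop_monotone => Y g.
by rewrite -[lop j]comp_idr; apply: lop_infl.
Qed.

Lemma lop_le_compl j k : lop_le j k -> lop j ∘ lop k = lop k.
Proof.
move=> le_jk; apply: omega_ext => X f; split; last exact: lop_infl.
by rewrite -{2}(lop_idem k); apply: lop_le_truth.
Qed.

Lemma is_join_sheaf k j l l' : is_join k j l -> is_join k j l' ->
  forall X : E, is_sheaf l X <-> is_sheaf l' X.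
Proof.
by move=> [kl [jl ul]] [kl' [jl' ul']] X; split; [apply: ul' | apply: ul].
Qed.

End Order.

(** * The composite operator and the join *)

Section Composite.
Context (E : Topos) (j k : local_operator E).
Context (jkj : lop j ∘ (lop k ∘ lop j) = lop k ∘ lop j).

Lemma comp_lop_tr : (lop k ∘ lop j) ∘ tr = tr.
Proof. by rewrite -compA !lop_tr. Qed.

Lemma comp_lop_idem : (lop k ∘ lop j) ∘ (lop k ∘ lop j) = lop k ∘ lop j.
Proof. by rewrite -compA jkj compA lop_idem. Qed.

Lemma comp_lop_meet :
  (lop k ∘ lop j) ∘ meet E =
  meet E ∘ pair ((lop k ∘ lop j) ∘ fst) ((lop k ∘ lop j) ∘ snd).
Proof. by rewrite -compA lop_meet lop_meetE !compA. Qed.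

Definition comp_lop : local_operator E :=
  {| lop := lop k ∘ lop j;
     lop_tr := comp_lop_tr;
     lop_idem := comp_lop_idem;
     lop_meet := comp_lop_meet |}.

Lemma comp_lop_ge_inner : lop_le j comp_lop.
Proof.
move=> X sX U A m hm dm; apply: sX.
by rewrite /dense /= -compA dm lop_truth.
Qed.

Lemma comp_lop_ge_outer : lop_le k comp_lop.
Proof.
move=> X sX U A m hm dm; apply: sX; rewrite /dense /= -compA.
rewrite -(comp_idr (_ ∘ _)).
apply: (@lop_monotone _ _ _ (chi hm)); first by move=> Y f; apply: lop_infl.
by rewrite comp_idr.
Qed.

Lemma comp_lop_closed (A : E) (x : Hom A (Omega E)) :
  lop j ∘ x = x -> lop k ∘ x = x -> lop comp_lop ∘ x = x.
Proof. by move=> jx kx; rewrite /= -compA jx. Qed.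

(* A [k ∘ j]-dense mono factors as a [j]-dense mono into its [j]-closure,
   followed by a [k]-dense one. *)
Lemma sheaf_comp_lop (X : E) :
  is_sheaf j X -> is_sheaf k X -> is_sheaf comp_lop X.
Proof.
move=> sj sk U A m hm dm f.
pose x := lop j ∘ chi hm; pose hc := @eqz_mono E _ _ x (truth A).
have dc : dense k hc by rewrite /dense chi_eqz compA.
have xm : x ∘ m = truth A ∘ m.
  rewrite truth_comp; apply: lop_infl; apply/chiP.
  by exists (idm U); rewrite comp_idr.
pose d := eqz_lift xm; have ed : eqz_arr x (truth A) ∘ d = m := eqz_liftE xm.
have hd : mono d by move=> Y a b e; apply: (hm); rewrite -ed -!compA e.
have dd : dense j hd.
  rewrite /dense; suff -> : chi hd = chi hm ∘ eqz_arr x (truth A).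
    by rewrite compA eqz_eq truth_comp.
  apply: omega_ext => Y a; rewrite -compA -!chiP; split=> -[h e]; exists h.
    by rewrite -e compA ed.
  by apply: (hc); rewrite compA ed.
have [g [eg _]] := sj _ _ _ _ dd f.
have [h [eh _]] := sk _ _ _ _ dc g.
exists h; split; first by rewrite -ed compA eh.
move=> h' e; apply: (sheaf_sep sk dc); apply: (sheaf_sep sj dd).
by rewrite -!compA ed e -eg -eh -compA ed.
Qed.

Lemma comp_lop_join : is_join k j comp_lop.
Proof.
split; first exact: comp_lop_ge_outer.
split; first exact: comp_lop_ge_inner.
by move=> n kn jn X sX; apply: sheaf_comp_lop; [apply: jn | apply: kn].
Qed.

End Composite.

(** * Sheaves and closures for the relativized operator *)

Section Relativization.
Context (E : Topos) (j k : local_operator E) (k' : local_operator (sh j)).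
Context (hk' : is_relativization k k').

(** [lop j] factors through [e_j j], and [lop k ∘ e_j j] is [e_j j] after [k'], so its values are
    [j]-closed. *)
Lemma relativization_comp : lop j ∘ (lop k ∘ lop j) = lop k ∘ lop j.
Proof.
rewrite -{2 3}(Omega_liftE (lop_idem j)) [lop k ∘ _]compA -hk' -compA.
exact: closed_Omega_j.
Qed.

Lemma relativization_arr (A : E) (x : Hom A (Omega_j j)) :
  e_j j ∘ (sh_arr (lop k') ∘ x) = lop k ∘ (e_j j ∘ x).
Proof. by have := f_equal (fun w => w ∘ x) hk'; rewrite -!compA. Qed.

Lemma sh_truthE (A : sh j) : e_j j ∘ sh_arr (truth A) = truth (sh_val A).
Proof. by rewrite /sh_arr /= compA sh_trE. Qed.

Lemma sh_chi_inclE (U A : sh j) (m : Hom U A) (hm : mono m) :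
  e_j j ∘ sh_arr (chi hm) = chi (sh_mono hm).
Proof. exact: sh_chiE. Qed.

Lemma dense_relativization (U A : sh j) (m : Hom U A) (hm : mono m) :
  dense k' hm -> dense k (sh_mono hm).
Proof.
move=> dm; rewrite /dense -sh_chi_inclE -relativization_arr -sh_truthE.
by congr (_ ∘ _).
Qed.

Lemma sheaf_relativization (X : E) (hX : is_sheaf j X) :
  is_sheaf k X -> is_sheaf k' (Sheaf X hX).
Proof. by move=> sX U A m hm /dense_relativization dm f; apply: (sX _ _ _ _ dm). Qed.

(** A mono between sheaves is closed; this is used once in [E] for [j] and once in [sh j] for [k'],
    the latter carried to [k] along [e_j j]. *)
Lemma closed_sheaf_mono (U A : sh j) (m : Hom U A) (hm : mono m) :
  is_sheaf k' U -> is_sheaf k' A ->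
  lop (comp_lop relativization_comp) ∘ chi (sh_mono hm) = chi (sh_mono hm).
Proof.
move=> sU sA; apply: comp_lop_closed.
  by apply: sheaf_mono_closed; apply: sh_prf.
by rewrite -sh_chi_inclE -relativization_arr; congr (_ ∘ _);
  exact (sheaf_mono_closed hm sU sA).
Qed.

Lemma relativization_sheaf (X : E) (hX : is_sheaf j X) :
  is_sheaf k' (Sheaf X hX) -> is_sheaf (comp_lop relativization_comp) X.
Proof.
move=> sX; set l := comp_lop _.
pose X' : sh j := Sheaf X hX.
have hd : mono (@pair (sh j) _ _ _ (idm X') (idm X')).
  move=> Y f g /(f_equal (comp fst)).
  by rewrite !(@compA (sh j)) !fst_pair !comp_idl.
(* The diagonal is [l]-closed, so its classifier lifts to [Omega_j l] and its transpose is a mono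
   from [X] to a power. *)
have cd := closed_sheaf_mono hd sX (sheaf_prod sX sX).
have hs := mono_curry_diag (Omega_liftE cd).
have sF : is_sheaf l (exp X (Omega_j l)) := sheaf_exp (@sheaf_Omega_j E l).
have sFj : is_sheaf j (exp X (Omega_j l)) := comp_lop_ge_inner sF.
have sFk := sheaf_relativization (hX := sFj) (comp_lop_ge_outer sF).
have hs' : @mono (sh j) X' (Sheaf _ sFj) (curry (Omega_lift cd)).
  by move=> Y f g; apply: hs.
(* The power is an [l]-sheaf, hence also a [k']-sheaf, which makes the singleton map [l]-closed. *)
exact: (sheaf_closed_sub sF (closed_sheaf_mono hs' sX sFk)).
Qed.

Lemma chi_incl_closure (L : sheafification k') (A : sh j) (m : Sub A) :
  chi (sub_mono (s := sub_incl (closure L m))) =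
  lop k ∘ chi (sub_mono (s := sub_incl m)).
Proof.
rewrite -[RHS](f_equal (comp _) (sh_chi_inclE (sub_mono (s := m)))).
rewrite -relativization_arr -[LHS](sh_chi_inclE (sub_mono (s := closure L m))).
(* Here [chi_closure] is applied inside the topos [sh j]. *)
by congr (_ ∘ _); exact (chi_closure L m).
Qed.

End Relativization.

(* Classifying maps of subobjects of a sheaf land in the sheaf [Omega_j], hence
   are determined by their restriction along the unit. *)
Lemma sub_eq_eta (E : Topos) (j : local_operator E) (L : sheafification j)
    (A : E) (s t : Sub (L_ob L A)) :
  chi (sub_mono (s := sub_incl s)) ∘ eta L A =
  chi (sub_mono (s := sub_incl t)) ∘ eta L A -> sub_eq s t.
Proof.
rewrite -(sh_chi_inclE (sub_mono (s := s))) -(sh_chi_inclE (sub_mono (s := t))).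
rewrite -!compA => /(@eqz_mono E) e; apply/sub_eqP.
have [y [_ uy]] := @eta_univ _ _ L A (sh_Omega j)
  (sh_arr (chi (sub_mono (s := t))) ∘ eta L A).
by rewrite -(uy _ e) -(uy (chi (sub_mono (s := t)))).
Qed.

Theorem theorem6p3 (E : Topos) (j k : local_operator E)
    (k' : local_operator (sh j)) (hk' : is_relativization k k') :
  ((exists l : local_operator E, is_join k j l) /\
   (forall l : local_operator E, is_join k j l ->
      forall X : E,
        (exists hX : is_sheaf j X, @is_sheaf (sh j) k' (Sheaf X hX)) <->
        is_sheaf l X))
  /\
  (forall (Lk : sheafification k) (Lk' : sheafification k')
      (A : sh j) (m : Sub A),
     sub_eq (sub_incl (closure Lk' m)) (closure Lk (sub_incl m)))
  /\
  (lop_le j k ->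
   forall (Lj : sheafification j) (Lk : sheafification k)
      (Lk' : sheafification k') (A : E) (m : Sub A),
     sub_eq (sub_pull (eta Lj A) (sub_incl (closure Lk' (L_sub Lj m))))
            (closure Lk m) /\
     sub_eq (closure Lk' (L_sub Lj m)) (L_sub Lj (closure Lk m))).
Proof.
split; [split|split].
- by exists (comp_lop (relativization_comp hk')); apply: comp_lop_join.
- move=> l hl X.
  (* All joins of [k] and [j] have the same sheaves, so [l] may be taken to be [k ∘ j]. *)
  rewrite (is_join_sheaf hl (comp_lop_join (relativization_comp hk'))); split.
    by case=> hX; apply: relativization_sheaf.
  move=> sX; exists (comp_lop_ge_inner sX).
  exact (sheaf_relativization hk' (comp_lop_ge_outer sX)).
- move=> Lk Lk' A m; apply/sub_eqP.
  by rewrite (chi_incl_closure hk') chi_closure.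
- move=> le_jk Lj Lk Lk' A m.
  (* Pulling [L_j m] back along the unit gives the [j]-closure of [m], and [k ∘ j = k]. *)
  have eta_m : (lop k ∘ chi (sub_mono (s := sub_incl (L_sub Lj m)))) ∘ eta Lj A =
      lop k ∘ chi (sub_mono (s := m)).
    rewrite -compA -chi_pull -/(closure Lj m) chi_closure compA.
    by rewrite lop_le_compr.
  split.
    by apply/sub_eqP; rewrite chi_pull (chi_incl_closure hk') chi_closure.
  (* Restricted along the unit, the right-hand side becomes the [j]-closure of the [k]-closure of
     [m], and [j ∘ k = k]. *)
  apply: sub_eq_eta; rewrite (chi_incl_closure hk') eta_m.
  rewrite -chi_pull -/(closure Lj (closure Lk m)) !chi_closure compA.
  by rewrite lop_le_compl.
Qed.
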